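(* Let $\mathbb{K}=\mathbb{H}$ (quaternions) and $n=7$, or $\mathbb{K}=\mathbf{Ca}$ (Cayley numbers) and $n=15$, and let $S^{n-1}=\{(p,w)\in\mathbb{K}\times\mathbb{K} : \Re(p)=0,\ |p|^2+|w|^2=1\}$. Let $\sigma:S^{n-1}\to S^{n-1}$ be the diffeomorphism $\sigma(p,w)=\bigl(\mathrm{b}(p,w)\,p\,\overline{\mathrm{b}(p,w)},\ \mathrm{b}(p,w)\,w\,\overline{\mathrm{b}(p,w)}\bigr)$ and let $\alpha(x)=-x$ be the antipodal map. Let $\mathcal{A}$ be the $\mathbb{Z}_2$-action on $\mathrm{Diff}^+(S^{n-1})$ given by $\mathcal{A}(h)=\alpha\circ h\circ\alpha^{-1}=\alpha\circ h\circ\alpha$, and denote also by $\mathcal{A}$ the induced action on $\Gamma_n=\pi_0\,\mathrm{Diff}^+(S^{n-1})$. Then $$\alpha\sigma=\sigma^{-1}\alpha,\qquad\text{equivalently}\qquad \mathcal{A}(\sigma)=\sigma^{-1}.$$ Thus the action $\mathcal{A}$ on $\Gamma_7\cong\mathbb{Z}_{28}$ and on the subgroup $bP^{16}\cong\mathbb{Z}_{8128}$ of $\Gamma_{15}$ is given by $\mathcal{A}(x)=-x$.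
   Context: $\Re$ denotes the real part. $\mathrm{Diff}^+(S^{n-1})$ is the group of orientation-preserving diffeomorphisms, and $\Gamma_n=\pi_0\,\mathrm{Diff}^+(S^{n-1})$ is the (abelian) group of isotopy classes. For $n\ge5$, $\Gamma_n$ is isomorphic to the group $\Theta_n$ of h-cobordism classes of homotopy $n$-spheres (by gluing two $n$-disks along a diffeomorphism), and $bP^{n+1}\subset\Theta_n\cong\Gamma_n$ is the subgroup of classes of homotopy spheres that bound parallelizable manifolds. The map $\mathrm{b}:S^{n-1}\to\{x\in\mathbb{K}:|x|=1\}$ is defined by $\mathrm{b}(p,w)=\frac{w}{|w|}\,e^{\pi p}\,\frac{\bar w}{|w|}$ if $w\neq0$ and $\mathrm{b}(p,0)=-1$, where for purely imaginary $p$ one has $e^{\pi p}=\cos(\pi|p|)+\sin(\pi|p|)\,\frac{p}{|p|}$ (and $e^0=1$); it is real analytic. In the Cayley case all products are unambiguous, since the subalgebra generated by two elements $p,w$ (together with conjugation) is associative. It is known (from earlier work) that $\sigma$ is a real analytic, orientation-preserving diffeomorphism, that its isotopy class generates $\Gamma_7\cong\mathbb{Z}_{28}$ when $n=7$, and that it generates $bP^{16}\cong\mathbb{Z}_{8128}\subset\Gamma_{15}\cong\mathbb{Z}_{8128}\times\mathbb{Z}_2$ when $n=15$. *)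

(* Defs.v *)
From HB Require Import structures.
From mathcomp Require Import all_boot all_order all_algebra generic_quotient.
From mathcomp Require Import all_classical all_reals all_analysis.

Set Implicit Arguments.
Unset Strict Implicit.
Unset Printing Implicit Defensive.

Import Order.TTheory GRing.Theory Num.Theory.
Import numFieldNormedType.Exports.

Local Open Scope quotient_scope.
Local Open Scope classical_set_scope.
Local Open Scope ring_scope.

(* The tangent map of [f] is (x, v) |-> (f x, df_x v); [f] is of class C^(k+1)
   when it is differentiable with a tangent map of class C^k.  For finite
   dimensional [V] this is the usual class C^(k+1). *)
Fixpoint Ck {R : realType} (k : nat) {V W : normedModType R}
    (U : set V) (f : V -> W) {struct k} : Prop :=
  match k with
  | 0 => forall x, U x -> {for x, continuous f}
  | k'.+1 => (forall x, U x -> differentiable f x) /\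
             @Ck R k' (V * V)%type (W * W)%type (U `*` setT)
                 (fun z => (f z.1, 'd f (z.1) z.2))
  end.

Definition Cinf {R : realType} {V W : normedModType R}
  (U : set V) (f : V -> W) : Prop := forall k, Ck k U f.

Section Smooth.
Context {R : realType}.
Implicit Types V W Z : normedModType R.

(* [T] is viewed as a subset of [V] through the injection [i]. *)
Definition local_extension {T : Type} {V W} (i : T -> V) (f : T -> W)
    (x : T) (F : V -> W) : Prop :=
  exists U : set V,
    [/\ open U, U (i x), Cinf U F & forall y, U (i y) -> F (i y) = f y].

Definition smooth_along {T : Type} {V W} (i : T -> V) (f : T -> W) : Prop :=
  forall x, exists F, local_extension i f x F.

Definition smooth {V W} {X : set V} {Y : set W} (f : X -> Y) : Prop :=
  smooth_along (@set_val V X) (@set_val W Y \o f).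

Definition diffeomorphism {V W} {X : set V} {Y : set W} (f : X -> Y) : Prop :=
  smooth f /\
  exists g : Y -> X, [/\ cancel f g, cancel g f & smooth g].

(* Velocities at [x] of curves that stay in [X] on one side of time 0: at a
   boundary point of a manifold with boundary the two sides give the two
   halves of the tangent space. *)
Definition tangent {V} (X : set V) (x v : V) : Prop :=
  exists c : R -> V,
    [/\ c 0 = x, is_derive (0 : R) 1 c v &
        (\forall t \near (0 : R)^'+, X (c t)) \/
        (\forall t \near (0 : R)^'-, X (c t))].

End Smooth.

Section SmoothLemmas.
Context {R : realType}.
Implicit Types V W Z : normedModType R.

Lemma eq_on_diff V W (U : set V) (f g : V -> W) x :
  open U -> U x -> (forall y, U y -> f y = g y) ->
  differentiable f x -> differentiable g x /\ 'd g x = 'd f x :> (V -> W).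
Proof.
move=> Uo Ux fg df.
have ext : g \o shift x = cst (g x) + 'd f x +o_ 0 id.
  have /eqaddoP H := diff_locally df.
  apply/eqaddoP => e e0; have := H e e0.
  have Un : \forall h \near (0 : V), U (h + x).
    have : {for (0 : V), continuous (fun h : V => h + x)}.
      by apply: continuousD => //; exact: cst_continuous.
    by apply; rewrite add0r; exact: open_nbhs_nbhs.
  apply: filterS2 Un => h Uh /=.
  by rewrite !fctE /= /shift /= -(fg _ Uh) -(fg _ Ux).
have dE : 'd g x = 'd f x :> (V -> W) by apply: diff_unique ext; exact: diff_continuous.
split => //; apply/diff_locallyP; rewrite dE; split=> //.
exact: diff_continuous.
Qed.

Lemma openTx V W (U : set V) : open U -> open (U `*` [set: W]).
Proof.
move=> Uo; have -> : U `*` [set: W] = fst @^-1` U.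
  by apply/seteqP; split=> -[x y] /=; [case|].
by apply: open_comp => // z _; exact: cvg_fst.
Qed.

Lemma eq_on_Ck k V W (U : set V) (f g : V -> W) :
  open U -> (forall y, U y -> f y = g y) -> Ck k U f -> Ck k U g.
Proof.
elim: k V W U f g => [|k IH] V W U f g Uo fg /=.
  move=> cf x Ux; rewrite /prop_for /continuous_at -(fg _ Ux).
  apply: cvg_trans (cf x Ux); apply: near_eq_cvg.
  by apply: filterS (open_nbhs_nbhs (conj Uo Ux)) => y /fg.
move=> [df Tf]; split.
  by move=> x Ux; have [] := eq_on_diff Uo Ux fg (df x Ux).
apply: IH Tf; first exact: openTx.
move=> [x v] [/= Ux _]; rewrite (fg _ Ux); congr pair.
have [_ dE] := eq_on_diff Uo Ux fg (df x Ux).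
exact: esym (congr1 (fun h : V -> W => h v) dE).
Qed.

Lemma sub_Ck k V W (U U' : set V) (f : V -> W) :
  U' `<=` U -> Ck k U f -> Ck k U' f.
Proof.
elim: k V W U U' f => [|k IH] V W U U' f sU /=; first by move=> cf x /sU/cf.
move=> [df Tf]; split; first by move=> x /sU/df.
by apply: IH Tf => -[x v] [/= /sU Ux _].
Qed.

Lemma Ck_continuous k V W (U : set V) (f : V -> W) x :
  Ck k U f -> U x -> {for x, continuous f}.
Proof.
case: k => [/(_ x)//|k] [df _] Ux; exact: differentiable_continuous (df _ Ux).
Qed.

Lemma Ck_comp k V W Z (U : set V) (U' : set W) (f : V -> W) (g : W -> Z) :
  open U -> (forall x, U x -> U' (f x)) ->
  Ck k U f -> Ck k U' g -> Ck k U (g \o f).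
Proof.
elim: k V W Z U U' f g => [|k IH] V W Z U U' f g Uo fU /=.
  by move=> cf cg x Ux; apply: continuous_comp; [exact: cf|exact/cg/fU].
move=> [df Tf] [dg Tg]; split.
  by move=> x Ux; apply: differentiable_comp; [exact: df|exact/dg/fU].
have := IH _ _ _ _ (U' `*` setT) _ _ (openTx Uo) _ Tf Tg.
move=> /(_ (fun z Uz => conj (fU _ Uz.1) I)).
apply: eq_on_Ck; first exact: openTx.
move=> [x v] [/= Ux _]; by rewrite (diff_comp (df _ Ux) (dg _ (fU _ Ux))).
Qed.

Lemma Cinf_comp V W Z (U : set V) (U' : set W) (f : V -> W) (g : W -> Z) :
  open U -> (forall x, U x -> U' (f x)) ->
  Cinf U f -> Cinf U' g -> Cinf U (g \o f).
Proof. by move=> Uo fU sf sg k; apply: Ck_comp (sf k) (sg k). Qed.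

Lemma Ck_affine k V W (U : set V) (f : {linear V -> W}) (a : W) :
  open U -> continuous f -> Ck k U (fun x => a + f x).
Proof.
elim: k V W U f a => [|k IH] V W U f a Uo cf.
  move=> x _; apply: continuousD; [exact: cst_continuous|exact: cf].
have dfx x : differentiable f x by exact: linear_differentiable.
have daf x : is_diff x (fun x => a + f x) f.
  have -> : (fun x => a + f x) = cst a + (f : V -> W) by [].
  apply: DiffDef.
    by apply: differentiableD; [exact: differentiable_cst|exact: dfx].
  rewrite (diffD (differentiable_cst a x) (dfx x)) diff_cst.
  by apply/funext => y; rewrite -[LHS]/(0 + 'd f x y) add0r diff_lin.
split; first by move=> x _; exact: ex_diff.
pose Tf (z : V * V) : W * W := (f z.1, f z.2).
have TfL : linear Tf by move=> c u v; rewrite /Tf /= !linearP.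
pose TfM := GRing.isLinear.Build _ _ _ _ _ TfL.
pose L : {linear (V * V)%type -> (W * W)%type} := HB.pack Tf TfM.
have : Ck k (U `*` setT) (fun z => (a, 0 : W) + L z).
  apply: IH; first exact: openTx.
  move=> z; apply: cvg_pair; apply: continuous_comp => //.
  - exact: cvg_fst.
  - exact: cf.
  - exact: cvg_snd.
  - exact: cf.
apply: eq_on_Ck; first exact: openTx.
move=> [x v] _; rewrite (@diff_val _ _ _ _ _ _ _ (daf x)) /=.
by rewrite /Tf/=; congr pair; rewrite /= add0r.
Qed.

Lemma Ck_lin k V W (U : set V) (f : {linear V -> W}) :
  open U -> continuous f -> Ck k U f.
Proof.
move=> Uo cf; apply: (eq_on_Ck Uo (f := fun x => 0 + f x)) (Ck_affine _ _ Uo cf).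
by move=> y _; rewrite add0r.
Qed.

Lemma continuous_pair V W Z (f : V -> W) (g : V -> Z) :
  continuous f -> continuous g -> continuous (fun x => (f x, g x)).
Proof. by move=> cf cg x; apply: cvg_pair; [exact: cf|exact: cg]. Qed.

Lemma Ck_pair k V W Z (U : set V) (f : V -> W) (g : V -> Z) :
  open U -> Ck k U f -> Ck k U g -> Ck k U (fun x => (f x, g x)).
Proof.
elim: k V W Z U f g => [|k IH] V W Z U f g Uo /=.
  by move=> cf cg x Ux; apply: cvg_pair; [exact: cf|exact: cg].
move=> [df Tf] [dg Tg]; split.
  by move=> x Ux; apply: differentiable_pair; [exact: df|exact: dg].
pose sw (z : (W * W) * (Z * Z)) : (W * Z) * (W * Z) :=
  ((z.1.1, z.2.1), (z.1.2, z.2.2)).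
have swL : linear sw by move=> c [[? ?] [? ?]] [[? ?] [? ?]].
pose swM := GRing.isLinear.Build _ _ _ _ _ swL.
pose L : {linear ((W * W) * (Z * Z))%type -> ((W * Z) * (W * Z))%type} :=
  HB.pack sw swM.
have cL : continuous L.
  have c1 (A B : normedModType R) : continuous (fst : A * B -> A).
    by move=> z; exact: cvg_fst.
  have c2 (A B : normedModType R) : continuous (snd : A * B -> B).
    by move=> z; exact: cvg_snd.
  have cc (A B C : normedModType R) (u : A -> B) (v : B -> C) :
      continuous u -> continuous v -> continuous (v \o u).
    by move=> cu cv z; apply: continuous_comp; [exact: cu|exact: cv].
  apply: continuous_pair; apply: continuous_pair.
  - exact: (cc _ _ _ fst fst (@c1 _ _) (@c1 _ _)).
  - exact: (cc _ _ _ snd fst (@c2 _ _) (@c1 _ _)).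
  - exact: (cc _ _ _ fst snd (@c1 _ _) (@c2 _ _)).
  - exact: (cc _ _ _ snd snd (@c2 _ _) (@c2 _ _)).
have CL : Ck k setT L by apply: Ck_lin => //; exact: openT.
have CT := IH _ _ _ _ _ _ (openTx Uo) Tf Tg.
have := Ck_comp (openTx Uo) (fun _ _ => I) CT CL.
apply: eq_on_Ck; first exact: openTx.
move=> [x v] [/= Ux _]; by rewrite (diff_pair (df _ Ux) (dg _ Ux)).
Qed.

Lemma Cinf_id V : Cinf setT (@idfun V).
Proof. by move=> k; apply: (@Ck_lin _ _ _ _ idfun); [exact: openT|move=> z; exact: cvg_id]. Qed.

Lemma open_preim V W (U : set V) (U' : set W) (f : V -> W) :
  open U -> open U' -> (forall x, U x -> {for x, continuous f}) ->
  open (U `&` f @^-1` U').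
Proof.
move=> Uo U'o cf; rewrite openE => x [Ux fx].
apply: filterI; first exact: open_nbhs_nbhs.
by apply: (cf x Ux); exact: open_nbhs_nbhs.
Qed.

Lemma local_extension_comp (T T' : Type) V W Z (i : T -> V) (j : T' -> W)
    (f : T -> T') (g : T' -> Z) x F G :
  local_extension i (j \o f) x F -> local_extension j g (f x) G ->
  local_extension i (g \o f) x (G \o F).
Proof.
move=> [U [Uo Ux sF FE]] [U' [U'o U'x sG GE]].
exists (U `&` F @^-1` U'); split.
- by apply: open_preim => // y Uy; exact: Ck_continuous (sF 0%N) Uy.
- by split => //=; rewrite FE.
- apply: Cinf_comp sG => //.
  + by apply: open_preim => // y Uy; exact: Ck_continuous (sF 0%N) Uy.
  + by move=> y [].
  + by move=> k; apply: sub_Ck (sF k) => y [].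
- by move=> y [Uy /=]; rewrite FE //= => /GE.
Qed.

Lemma smooth_along_comp (T T' : Type) V W Z (i : T -> V) (j : T' -> W)
    (f : T -> T') (g : T' -> Z) :
  smooth_along i (j \o f) -> smooth_along j g -> smooth_along i (g \o f).
Proof.
move=> sf sg x; have [F hF] := sf x; have [G hG] := sg (f x).
by exists (G \o F); exact: local_extension_comp hF hG.
Qed.

Lemma smooth_along_pair (T : Type) V W Z (i : T -> V) (f : T -> W) (g : T -> Z) :
  smooth_along i f -> smooth_along i g ->
  smooth_along i (fun x => (f x, g x)).
Proof.
move=> sf sg x; have [F [U [Uo Ux sF FE]]] := sf x.
have [G [U' [U'o U'x sG GE]]] := sg x.
exists (fun y => (F y, G y)), (U `&` U'); split.
- exact: openI.
- by split.
- move=> k; apply: Ck_pair; first exact: openI.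
  + by apply: sub_Ck (sF k) => y [].
  + by apply: sub_Ck (sG k) => y [].
- by move=> y [Uy U'y]; rewrite FE// GE.
Qed.

Lemma smooth_along_self (T : Type) V (i : T -> V) : smooth_along i i.
Proof. by move=> x; exists idfun, setT; split=> //; [exact: openT|exact: Cinf_id]. Qed.

Lemma smooth_along_affine (T : Type) V W (i : T -> V) (f : {linear V -> W}) a :
  continuous f -> smooth_along i (fun x => a + f (i x)).
Proof.
move=> cf x; exists (fun y => a + f y), setT; split => //; first exact: openT.
by move=> k; apply: Ck_affine => //; exact: openT.
Qed.

Lemma smooth_along_lin (T : Type) V W (i : T -> V) (f : {linear V -> W}) :
  continuous f -> smooth_along i (f \o i).
Proof.
move=> cf x; exists f, setT; split => //; first exact: openT.
by move=> k; apply: Ck_lin => //; exact: openT.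
Qed.

Lemma smooth_comp V W Z (X : set V) (Y : set W) (Y' : set Z)
    (f : X -> Y) (g : Y -> Y') : smooth f -> smooth g -> smooth (g \o f).
Proof. exact: smooth_along_comp. Qed.

Lemma local_extension_differentiable (T : Type) V W (i : T -> V) (f : T -> W) x F :
  local_extension i f x F -> differentiable F (i x).
Proof. by move=> [U [_ Ux /(_ 1%N) [+ _] _]]; exact. Qed.

Lemma diff_comp_at V W Z (F : W -> Z) (G : V -> W) x y u :
  G x = y -> differentiable G x -> differentiable F y ->
  'd (F \o G) x u = 'd F y ('d G x u).
Proof.
by move=> <- dG dF; exact: (congr1 (fun h : V -> Z => h u) (diff_comp dG dF)).
Qed.

Lemma is_derive_diff V W (c : R -> V) (v : V) (F : V -> W) :
  is_derive (0 : R) 1 c v -> differentiable F (c 0) ->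
  is_derive (0 : R) 1 (F \o c) ('d F (c 0) v).
Proof.
move=> [dc <-] dF; have dc' : differentiable c 0 by apply/derivable1_diffP.
apply: DeriveDef.
  by apply/derivable1_diffP; exact: differentiable_comp.
rewrite deriveE; last exact: differentiable_comp.
by rewrite diff_comp //= deriveE.
Qed.

Lemma set_valS V (X : set V) (y : V) : X y -> exists z : X, set_val z = y.
Proof. by move=> Xy; exists (SigSub (mem_set Xy)). Qed.

Lemma curve_nbhs V (c : R -> V) v (U : set V) :
  is_derive (0 : R) 1 c v -> open U -> U (c 0) -> \forall t \near (0 : R), U (c t).
Proof.
move=> [dc _] Uo U0; have : {for 0, continuous c}.
  exact/differentiable_continuous/derivable1_diffP.
by apply; exact: open_nbhs_nbhs.
Qed.

Lemma tangent_image V W (X : set V) (Y : set W) (f : X -> Y) (x : X) F v :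
  local_extension (@set_val _ X) (@set_val _ Y \o f) x F ->
  tangent X (set_val x) v -> tangent Y (set_val (f x)) ('d F (set_val x) v).
Proof.
move=> hF [c [c0 dc side]]; have dF := local_extension_differentiable hF.
have [U [Uo Ux _ FE]] := hF.
have Uc : \forall t \near (0 : R), U (c t).
  by apply: (curve_nbhs dc Uo); rewrite c0.
have key t : X (c t) -> U (c t) -> Y (F (c t)).
  move=> /set_valS[y ycE]; rewrite -ycE => /FE ->; exact: set_valP.
exists (F \o c); split.
- by rewrite /= c0 FE.
- by rewrite -c0; apply: is_derive_diff => //; rewrite c0.
- case: side => side; [left|right]; apply: filterS2 side _;
    try exact: key; exact: cvg_within Uc.
Qed.

Lemma derive_eq_side (W : normedModType R) (c c' : R -> W) (a b : W) :
  is_derive (0 : R) 1 c a -> is_derive (0 : R) 1 c' b -> c 0 = c' 0 ->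
  (\forall t \near (0 : R)^'+, c t = c' t) \/
  (\forall t \near (0 : R)^'-, c t = c' t) -> a = b.
Proof.
move=> [dc <-] [dc' <-] c0 side.
have side_cvg (D : set_system R) : ProperFilter D ->
    (forall e : R -> W, derivable e 0 1 ->
       (fun t => t^-1 *: (e (t *: 1 + 0) - e 0)) @ D --> 'D_1 e 0) ->
    (\forall t \near D, c t = c' t) -> 'D_1 c 0 = 'D_1 c' 0.
  move=> PD h Dc; apply: (cvg_unique _ (h c dc)) => //.
  apply: cvg_trans (h c' dc'); apply: near_eq_cvg.
  by apply: filterS Dc => t ct; rewrite [t *: 1]mulr1 addr0 ct c0.
case: side; apply: side_cvg => e de.
- exact: cvg_dnbhs_at_right.
- exact: cvg_dnbhs_at_left.
Qed.

Lemma diff_local_extension V W (X : set V) (f : X -> W) (x : X) F G u :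
  local_extension (@set_val _ X) f x F -> local_extension (@set_val _ X) f x G ->
  tangent X (set_val x) u -> 'd F (set_val x) u = 'd G (set_val x) u.
Proof.
move=> hF hG [c [c0 dc side]].
have dF := local_extension_differentiable hF.
have dG := local_extension_differentiable hG.
have [U [Uo Ux _ FE]] := hF; have [U' [U'o U'x _ GE]] := hG.
have Uc : \forall t \near (0 : R), (U `&` U') (c t).
  by apply: (curve_nbhs dc (openI Uo U'o)); rewrite c0.
have key t : X (c t) -> (U `&` U') (c t) -> (F \o c) t = (G \o c) t.
  by move=> /set_valS[y /= <-] [Uy U'y]; rewrite FE // GE.
rewrite -c0 in dF dG *.
apply: derive_eq_side (is_derive_diff dc dF) (is_derive_diff dc dG) _ _.
  by rewrite /= c0 FE // GE.
case: side => side; [left|right]; apply: filterS2 side _;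
  try exact: key; exact: cvg_within Uc.
Qed.

End SmoothLemmas.

Fixpoint cd_dim (k : nat) : nat :=
  if k is k'.+1 then (cd_dim k' + cd_dim k')%N else 1%N.

(* R, C, the quaternions and the Cayley numbers are [cd R k] for k = 0, 1, 2, 3 *)
Notation cd R k := 'rV[R]_(cd_dim k).

Section CayleyDickson.
Context {R : realType}.

Definition cdfst {k} (x : cd R k.+1) : cd R k := @lsubmx R 1 (cd_dim k) (cd_dim k) x.
Definition cdsnd {k} (x : cd R k.+1) : cd R k := @rsubmx R 1 (cd_dim k) (cd_dim k) x.
Definition cdpair {k} (a b : cd R k) : cd R k.+1 := row_mx a b.

Fixpoint cd_of_real {k} (r : R) : cd R k :=
  match k with
  | 0 => const_mx r
  | _.+1 => cdpair (cd_of_real r) 0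
  end.

Fixpoint cd_re {k} : cd R k -> R :=
  match k with
  | 0 => fun x => x 0 0
  | _.+1 => fun x => cd_re (cdfst x)
  end.

Fixpoint cd_conj {k} : cd R k -> cd R k :=
  match k with
  | 0 => id
  | _.+1 => fun x => cdpair (cd_conj (cdfst x)) (- cdsnd x)
  end.

Fixpoint cd_mul {k} : cd R k -> cd R k -> cd R k :=
  match k with
  | 0 => fun x y => const_mx (x 0 0 * y 0 0)
  | _.+1 => fun x y =>
      let: (a, b) := (cdfst x, cdsnd x) in
      let: (c, d) := (cdfst y, cdsnd y) in
      cdpair (cd_mul a c - cd_mul (cd_conj d) b)
             (cd_mul d a + cd_mul b (cd_conj c))
  end.

Definition cd_abs {k} (x : cd R k) : R := Num.sqrt (\sum_i x 0 i ^+ 2).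

(* e^(pi p) for purely imaginary [p]; at p = 0 this is 1 since 0^-1 = 0 *)
Definition cd_exp_pi {k} (p : cd R k) : cd R k :=
  cd_of_real (cos (pi * cd_abs p)) +
  (sin (pi * cd_abs p) / cd_abs p) *: p.

Definition bmap {k} (p w : cd R k) : cd R k :=
  if w == 0 then - cd_of_real 1
  else cd_mul (cd_mul ((cd_abs w)^-1 *: w) (cd_exp_pi p))
              ((cd_abs w)^-1 *: cd_conj w).

Definition sigma {k} (x : cd R k.+1) : cd R k.+1 :=
  let: (p, w) := (cdfst x, cdsnd x) in
  let b := bmap p w in
  cdpair (cd_mul (cd_mul b p) (cd_conj b)) (cd_mul (cd_mul b w) (cd_conj b)).

End CayleyDickson.

Section Sphere.
Context (R : realType) (k : nat).

(* of dimension 2 ^ (k + 1) - 2, hence S^6 for k = 2 and S^14 for k = 3 *)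
Definition sphere : set (cd R k.+1) :=
  [set x | cd_re (cdfst x) = 0 /\
           cd_abs (cdfst x) ^+ 2 + cd_abs (cdsnd x) ^+ 2 = 1].

Definition disk : set (cd R k.+1) :=
  [set x | cd_re (cdfst x) = 0 /\
           cd_abs (cdfst x) ^+ 2 + cd_abs (cdsnd x) ^+ 2 <= 1].

Lemma cd_reN j (x : cd R j) : cd_re (- x) = - cd_re x.
Proof.
by elim: j x => [|j IH] x /=; [rewrite mxE|rewrite /cdfst linearN IH].
Qed.

Lemma cd_absN j (x : cd R j) : cd_abs (- x) = cd_abs x.
Proof. by congr Num.sqrt; apply: eq_bigr => i _; rewrite mxE sqrrN. Qed.

Lemma sphereN x : sphere x -> sphere (- x).
Proof.
by move=> [re0 abs1]; split; rewrite /cdfst /cdsnd !linearN /= ?cd_reN ?re0 ?oppr0 ?cd_absN.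
Qed.

Definition antipode (x : sphere) : sphere :=
  SigSub (mem_set (sphereN (set_valP x))).

(* The sign of the tangent frame [v] at [x]: (v_1, ..., v_(n-1)) is compared
   with the standard basis of K * K after completion by the normal vectors
   (1, 0) of the hyperplane Re p = 0 and [x] of the sphere. *)
Definition frame_sign (x : cd R k.+1) (v : seq (cd R k.+1)) : R :=
  Num.sg (\det (\matrix_(i < cd_dim k.+1) nth 0 [:: cd_of_real 1, x & v] i)).

Definition orientation_preserving (f : sphere -> sphere) : Prop :=
  forall (x : sphere) (F : cd R k.+1 -> cd R k.+1) (v : seq (cd R k.+1)),
    local_extension (@set_val _ sphere) (@set_val _ sphere \o f) x F ->
    size v = (cd_dim k.+1 - 2)%N ->
    {in v, forall u, tangent sphere (set_val x) u} ->
    frame_sign (set_val (f x)) [seq 'd F (set_val x) u | u <- v] =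
    frame_sign (set_val x) v.

Record Diffp := MkDiffp {
  diffp_fun :> sphere -> sphere ;
  diffpP : diffeomorphism diffp_fun /\ orientation_preserving diffp_fun }.

HB.instance Definition _ := gen_eqMixin Diffp.
HB.instance Definition _ := gen_choiceMixin Diffp.

Lemma diffp_inj (f g : Diffp) : f =1 g -> f = g.
Proof.
case: f g => [f Pf] [g Pg] /= /funext fg; rewrite -{}fg in Pg *.
by congr MkDiffp; exact: Prop_irrelevance.
Qed.


Local Notation sphv := (@set_val _ sphere).

Lemma diff_ext_id (x : sphere) F u : local_extension sphv sphv x F ->
  tangent sphere (sphv x) u -> 'd F (sphv x) u = u.
Proof.
move=> hF tu; have hI : local_extension sphv sphv x idfun.
  by exists setT; split => //; [exact: openT|exact: Cinf_id].
by rewrite (diff_local_extension hF hI tu) diff_val.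
Qed.

Lemma orientation_id : orientation_preserving id.
Proof.
move=> x F v hF _ tv; congr frame_sign; rewrite -[RHS]map_id.
by apply/eq_in_map => u uv; apply: diff_ext_id => //; exact: tv.
Qed.

Lemma diff_ext_comp (f g : sphere -> sphere) x F G u :
  local_extension sphv (sphv \o g) x G ->
  local_extension sphv (sphv \o f) (g x) F ->
  'd (F \o G) (sphv x) u = 'd F (sphv (g x)) ('d G (sphv x) u).
Proof.
move=> hG hF; have [U [_ Ux _ GE]] := hG.
have GxE : G (sphv x) = sphv (g x) by exact: GE.
exact: (diff_comp_at u GxE (local_extension_differentiable hG)
  (local_extension_differentiable hF)).
Qed.

Lemma orientation_comp f g : smooth f -> smooth g ->
  orientation_preserving f -> orientation_preserving g ->
  orientation_preserving (f \o g).
Proof.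
move=> sf sg of_ og x F v hF sv tv.
have [Fg hg] := sg x; have [Ff hf] := sf (g x).
rewrite -(og x Fg v hg sv tv) -(of_ (g x) Ff _ hf).
- apply: (congr1 (frame_sign _)); apply: etrans (map_comp _ _ _).
  apply/eq_in_map => u uv.
  apply: etrans (diff_local_extension hF (local_extension_comp hg hf) (tv _ uv)) _.
  exact: (diff_ext_comp u hg hf).
- by rewrite size_map.
- by move=> _ /mapP[u uv ->]; apply: tangent_image => //; exact: tv.
Qed.

Lemma orientation_inv f g : smooth f -> smooth g -> cancel g f ->
  orientation_preserving f -> orientation_preserving g.
Proof.
move=> sf sg gK of_ x F v hF sv tv.
have [Ff hf] := sf (g x).
rewrite -(of_ (g x) Ff _ hf); first last.
- by move=> _ /mapP[u uv ->]; apply: tangent_image => //; exact: tv.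
- by rewrite size_map.
rewrite gK; apply: (congr1 (frame_sign _)).
apply: etrans (esym (map_comp _ _ _)) _; apply: etrans (map_id v).
apply/eq_in_map => u uv.
have E : (sphv \o f) \o g = sphv by apply/funext => y /=; rewrite gK.
have hFF : local_extension sphv sphv x (Ff \o F) :=
  eq_ind _ (fun h => local_extension sphv h x (Ff \o F))
    (local_extension_comp hF hf) _ E.
apply: etrans (esym (diff_ext_comp u hF hf)) _.
by apply: diff_ext_id => //; exact: tv.
Qed.

Lemma diffeomorphism_id : diffeomorphism (@id sphere).
Proof.
have sid : smooth (@id sphere) by exact: smooth_along_self.
by split=> //; exists id.
Qed.

Lemma diffeomorphism_comp (f g : sphere -> sphere) :
  diffeomorphism f -> diffeomorphism g -> diffeomorphism (f \o g).
Proof.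
move=> [sf [f' [fK f'K sf']]] [sg [g' [gK g'K sg']]].
split; first exact: smooth_comp sg sf.
exists (g' \o f'); split; last exact: smooth_comp sf' sg'.
- by move=> x /=; rewrite fK gK.
- by move=> x /=; rewrite g'K f'K.
Qed.

Definition diffp1 : Diffp := MkDiffp (conj diffeomorphism_id orientation_id).

Lemma diffp_mul_subproof (f g : Diffp) :
  diffeomorphism (f \o g) /\ orientation_preserving (f \o g).
Proof.
have [[df of_] [dg og]] := (diffpP f, diffpP g).
by split; [exact: diffeomorphism_comp|exact: orientation_comp df.1 dg.1 of_ og].
Qed.

Definition diffp_mul (f g : Diffp) : Diffp := MkDiffp (diffp_mul_subproof f g).

Lemma diffp_inv_subproof (f : Diffp) :
  exists g : Diffp, cancel f g /\ cancel g f.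
Proof.
have [[sf [g [fK gK sg]]] of_] := diffpP f.
have Pg : diffeomorphism g /\ orientation_preserving g.
  by split; [split=> //; exists f|exact: orientation_inv sf sg gK of_].
by exists (MkDiffp Pg).
Qed.

Definition diffp_inv (f : Diffp) : Diffp := sval (cid (diffp_inv_subproof f)).

Lemma diffp_mulA : associative diffp_mul.
Proof. by move=> f g h; exact: diffp_inj. Qed.

Lemma diffp_mul1 : left_id diffp1 diffp_mul.
Proof. by move=> f; exact: diffp_inj. Qed.

Lemma diffp_mulr1 : right_id diffp1 diffp_mul.
Proof. by move=> f; exact: diffp_inj. Qed.

Lemma diffp_mulV : left_inverse diffp1 diffp_inv diffp_mul.
Proof.
by move=> f; apply: diffp_inj => x; rewrite /= /diffp_inv; case: cid => g [] /=.
Qed.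

Lemma diffp_mulrV : right_inverse diffp1 diffp_inv diffp_mul.
Proof.
by move=> f; apply: diffp_inj => x; rewrite /= /diffp_inv; case: cid => g [] /=.
Qed.

HB.instance Definition _ := isGroup.Build Diffp
  diffp_mulA diffp_mul1 diffp_mulr1 diffp_mulV diffp_mulrV.

Lemma antipodeK : involutive antipode.
Proof. by move=> x; apply: val_inj; rewrite /= opprK. Qed.

Lemma set_val_antipode x : sphv (antipode x) = - sphv x.
Proof. by []. Qed.

Lemma smooth_antipode : smooth antipode.
Proof.
have E : sphv \o antipode = -%R \o sphv by apply/funext=> x; exact: set_val_antipode.
rewrite /smooth E; apply: (@smooth_along_lin _ _ _ _ sphv -%R).
exact: opp_continuous.
Qed.

Lemma diffeomorphism_antipode : diffeomorphism antipode.
Proof.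
by split; [|exists antipode; split => //]; first [exact: smooth_antipode|exact: antipodeK].
Qed.

Lemma frame_signN : exists e : R, forall x v,
  frame_sign (- x) (map -%R v) = e * frame_sign x v.
Proof.
pose d : 'rV[R]_(cd_dim k.+1) := \row_i (if (i : nat) == 0%N then 1 else -1).
exists (Num.sg (\det (diag_mx d))) => x v; rewrite /frame_sign -sgrM -det_mulmx.
congr (Num.sg (\det _)); apply/row_matrixP => i.
rewrite row_mul row_diag_mx -scalemxAl -rowE !rowK mxE.
case: (nat_of_ord i) => [|[|m]] /=; rewrite ?scale1r ?scaleN1r //.
have [mv|mv] := ltnP m (size v); first by rewrite (nth_map 0).
by rewrite !nth_default ?size_map // oppr0.
Qed.

Lemma orientation_antipode_conj f : smooth f -> orientation_preserving f ->
  orientation_preserving (antipode \o f \o antipode).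
Proof.
move=> sf of_ x F v hF sv tv; have [e sgN] := frame_signN.
have [Ff hf] := sf (antipode x).
have hN y : local_extension sphv (sphv \o antipode) y -%R.
  exists setT; split => //; first exact: openT.
  by move=> j; apply: Ck_lin; [exact: openT|exact: opp_continuous].
have dN y u : 'd (-%R : cd R k.+1 -> _) y u = - u.
  by rewrite diff_lin //; exact: opp_continuous.
have hfN : local_extension sphv (sphv \o (f \o antipode)) x (Ff \o -%R) :=
  local_extension_comp (hN x) hf.
have tN u : u \in v -> tangent sphere (sphv (antipode x)) (- u).
  by move=> uv; rewrite -(dN (sphv x)); apply: tangent_image; [exact: hN|exact: tv].
have dE : [seq 'd F (sphv x) u | u <- v] =
    map -%R [seq 'd Ff (sphv (antipode x)) u | u <- map -%R v].
  apply: etrans (map_comp _ _ _); apply: etrans (map_comp _ _ _).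
  apply/eq_in_map => u uv.
  have hc : local_extension sphv (sphv \o (antipode \o f \o antipode)) x
      (-%R \o (Ff \o -%R))  :=
    local_extension_comp (f := f \o antipode) hfN (hN _).
  apply: etrans (diff_local_extension hF hc (tv _ uv)) _.
  apply: etrans (diff_ext_comp u hfN (hN _)) _.
  apply: etrans (dN _ _) _; congr (- _).
  apply: etrans (diff_ext_comp u (hN x) hf) _.
  exact: congr1 (dN _ _).
apply: etrans (congr1 (frame_sign _) dE) _.
apply: etrans (sgN (sphv (f (antipode x))) _) _.
have -> := of_ (antipode x) Ff (map -%R v) hf.
- rewrite -sgN; apply: (congr2 frame_sign); first by rewrite /= opprK.
  apply: etrans (esym (map_comp _ _ _)) _; apply: etrans (map_id v).
  by apply: eq_map => u; rewrite /= opprK.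
- by rewrite size_map.
- by move=> _ /mapP[u uv ->]; exact: tN.
Qed.

Lemma antipode_conj_subproof (h : Diffp) :
  diffeomorphism (antipode \o h \o antipode) /\
  orientation_preserving (antipode \o h \o antipode).
Proof.
have [dh oh] := diffpP h; split; last exact: orientation_antipode_conj dh.1 oh.
by do 2?apply: diffeomorphism_comp => //; exact: diffeomorphism_antipode.
Qed.

Definition antipode_conj (h : Diffp) : Diffp := MkDiffp (antipode_conj_subproof h).

Definition isotopic (f g : Diffp) : Prop :=
  exists H : R -> Diffp, [/\ H 0 = f, H 1 = g &
    smooth_along
      (fun z : `[0, 1]%classic * sphere => (set_val z.1 : R, sphv z.2))
      (fun z => sphv (H (set_val z.1) z.2))].

Local Notation cyl := (`[0, 1]%classic * sphere)%type.
Local Notation cylv := (fun z : cyl => (set_val z.1 : R, sphv z.2)).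

Lemma smooth_cyl1 : smooth_along cylv (fun z => set_val z.1 : R).
Proof. by apply: (@smooth_along_lin _ _ _ _ cylv fst) => z; exact: cvg_fst. Qed.

Lemma smooth_cyl2 : smooth_along cylv (fun z => sphv z.2).
Proof. by apply: (@smooth_along_lin _ _ _ _ cylv snd) => z; exact: cvg_snd. Qed.

Lemma isotopic_refl f : isotopic f f.
Proof.
exists (fun=> f); split=> //; have [[sf _] _] := diffpP f.
exact: (smooth_along_comp (f := snd) smooth_cyl2 sf).
Qed.

Lemma isotopic_sym f g : isotopic f g -> isotopic g f.
Proof.
move=> [H [H0 H1 sH]]; exists (fun t => H (1 - t)); split.
- by rewrite subr0.
- by rewrite subrr.
have oneB (t : `[0, 1]%classic) : `[0, 1]%classic (1 - set_val t : R).
  by have := set_valP t; rewrite /= !in_itv /= subr_ge0 gerBl andbC.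
pose rev (z : cyl) : cyl := (SigSub (mem_set (oneB z.1)), z.2).
apply: (smooth_along_comp (f := rev) _ sH).
apply: (smooth_along_pair _ smooth_cyl2).
have cN : continuous (-%R \o fst : R * cd R k.+1 -> R).
  by move=> z; apply: continuousN; exact: cvg_fst.
exact: (@smooth_along_affine _ _ _ _ cylv (-%R \o fst) 1 cN).
Qed.

Lemma isotopic_mul f f' g g' :
  isotopic f f' -> isotopic g g' -> isotopic (f * g)%g (f' * g')%g.
Proof.
move=> [H [<- <- sH]] [K [<- <- sK]].
exists (fun t => H t * K t)%g; split=> //.
apply: (smooth_along_comp (f := fun z : cyl => (z.1, K (set_val z.1) z.2)) _ sH).
exact: smooth_along_pair smooth_cyl1 sK.
Qed.

Lemma isotopic_trans g f h : isotopic f g -> isotopic g h -> isotopic f h.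
Proof.
move=> fg gh; have := isotopic_mul (isotopic_mul gh (isotopic_refl g^-1%g)) fg.
by rewrite mulgV mul1g mulgVK.
Qed.

Lemma isotopic_inv f g : isotopic f g -> isotopic f^-1%g g^-1%g.
Proof.
move=> fg; apply: isotopic_sym.
have := isotopic_mul (isotopic_mul (isotopic_refl f^-1%g) fg) (isotopic_refl g^-1%g).
by rewrite mulVg mul1g mulgK.
Qed.

Lemma isotopic_antipode_conj f g :
  isotopic f g -> isotopic (antipode_conj f) (antipode_conj g).
Proof.
move=> [H [<- <- sH]]; exists (antipode_conj \o H); split=> //.
apply: (smooth_along_comp _ smooth_antipode).
apply: (smooth_along_comp (f := fun z : cyl => (z.1, antipode z.2)) _ sH).
apply: smooth_along_pair smooth_cyl1 _.
exact: (smooth_along_comp (f := snd) smooth_cyl2 smooth_antipode).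
Qed.

Definition isotopicb : rel Diffp := fun f g => `[< isotopic f g >].

Lemma isotopicb_refl : reflexive isotopicb.
Proof. by move=> f; apply/asboolP; exact: isotopic_refl. Qed.

Lemma isotopicb_sym : symmetric isotopicb.
Proof. by move=> f g; apply/asboolP/asboolP; exact: isotopic_sym. Qed.

Lemma isotopicb_trans : transitive isotopicb.
Proof.
by move=> g f h /asboolP fg /asboolP gh; apply/asboolP; exact: isotopic_trans gh.
Qed.

Canonical isotopic_equiv :=
  EquivRel isotopicb isotopicb_refl isotopicb_sym isotopicb_trans.

(* pi_0 Diff^+(S^(n-1)) = Gamma_n, written multiplicatively below *)
Definition Gamma : Type := {eq_quot isotopicb}.

HB.instance Definition _ := Choice.on Gamma.
HB.instance Definition _ : EqQuotient _ isotopicb Gamma := EqQuotient.on Gamma.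

Definition isotopy_class (f : Diffp) : Gamma := \pi_Gamma f.

Lemma isotopy_classP f g :
  reflect (isotopy_class f = isotopy_class g) `[< isotopic f g >].
Proof. exact: (@eqmodP _ isotopic_equiv f g). Qed.

Lemma isotopy_class_repr (x : Gamma) : isotopy_class (repr x) = x.
Proof. exact: reprK. Qed.

Lemma repr_isotopy_class f : isotopic (repr (isotopy_class f)) f.
Proof. by apply/asboolP/isotopy_classP; exact: isotopy_class_repr. Qed.

Definition gamma_mul (x y : Gamma) : Gamma := isotopy_class (repr x * repr y)%g.
Definition gamma_inv (x : Gamma) : Gamma := isotopy_class (repr x)^-1%g.
Definition gamma_one : Gamma := isotopy_class 1%g.
Definition gamma_antipode (x : Gamma) : Gamma :=
  isotopy_class (antipode_conj (repr x)).

Lemma gamma_mulE f g :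
  gamma_mul (isotopy_class f) (isotopy_class g) = isotopy_class (f * g)%g.
Proof.
by apply/isotopy_classP/asboolP/isotopic_mul; exact: repr_isotopy_class.
Qed.

Lemma gamma_invE f : gamma_inv (isotopy_class f) = isotopy_class f^-1%g.
Proof.
by apply/isotopy_classP/asboolP/isotopic_inv; exact: repr_isotopy_class.
Qed.

Lemma gamma_antipodeE f :
  gamma_antipode (isotopy_class f) = isotopy_class (antipode_conj f).
Proof.
by apply/isotopy_classP/asboolP/isotopic_antipode_conj; exact: repr_isotopy_class.
Qed.

Lemma gamma_ind (P : Gamma -> Prop) :
  (forall f, P (isotopy_class f)) -> forall x, P x.
Proof. by move=> Pf x; rewrite -(isotopy_class_repr x). Qed.

Lemma gamma_mulA : associative gamma_mul.
Proof.
elim/gamma_ind => f; elim/gamma_ind => g; elim/gamma_ind => h.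
by rewrite !gamma_mulE mulgA.
Qed.

Lemma gamma_mul1 : left_id gamma_one gamma_mul.
Proof. by elim/gamma_ind => f; rewrite gamma_mulE mul1g. Qed.

Lemma gamma_mulr1 : right_id gamma_one gamma_mul.
Proof. by elim/gamma_ind => f; rewrite gamma_mulE mulg1. Qed.

Lemma gamma_mulV : left_inverse gamma_one gamma_inv gamma_mul.
Proof. by elim/gamma_ind => f; rewrite gamma_invE gamma_mulE mulVg. Qed.

Lemma gamma_mulrV : right_inverse gamma_one gamma_inv gamma_mul.
Proof. by elim/gamma_ind => f; rewrite gamma_invE gamma_mulE mulgV. Qed.

HB.instance Definition _ := isGroup.Build Gamma
  gamma_mulA gamma_mul1 gamma_mulr1 gamma_mulV gamma_mulrV.

End Sphere.

Arguments sphere R k : clear implicits.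
Arguments disk R k : clear implicits.
Arguments antipode {R k} x.

Section Bounding.
Context {R : realType}.

Definition halfspace n : set 'rV[R]_n :=
  [set y | forall i : 'I_n, val i = 0%N -> 0 <= y 0 i].

Arguments halfspace n : clear implicits.

Definition halfspace_boundary n : set 'rV[R]_n :=
  [set y | forall i : 'I_n, val i = 0%N -> y 0 i = 0].

(* smooth [n]-dimensional submanifolds, with boundary, of R^N *)
Definition manifold {N} (n : nat) (W : set 'rV[R]_N) : Prop :=
  forall x, W x -> exists (U : set 'rV[R]_N) (V : set 'rV[R]_n)
    (f : (U `&` W)%classic -> (V `&` halfspace n)%classic),
    [/\ open U, U x, open V & diffeomorphism f].

Definition manifold_boundary {N} (n : nat) (W : set 'rV[R]_N) : set 'rV[R]_N :=
  [set x | exists (U : set 'rV[R]_N) (V : set 'rV[R]_n)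
    (f : (U `&` W)%classic -> (V `&` halfspace n)%classic),
    [/\ open U, open V, diffeomorphism f &
        exists2 y, set_val y = x & halfspace_boundary (set_val (f y))]].

Definition parallelizable {N} (n : nat) (W : set 'rV[R]_N) : Prop :=
  exists e : 'I_n -> W -> 'rV[R]_N,
    [/\ forall i, smooth_along (@set_val _ W) (e i),
        forall i x, tangent W (set_val x) (e i x) &
        forall x, row_free (\matrix_(i < n) e i x)].

(* [M] is obtained by gluing two disks along [h], which identifies the boundary
   point [x] of the first one with the boundary point [h x] of the second one *)
Definition twisted_double {k N} (h : Diffp R k) (M : set 'rV[R]_N) : Prop :=
  exists (A B : set 'rV[R]_N) (i : disk R k -> A) (j : disk R k -> B),
    [/\ diffeomorphism i, diffeomorphism j, M = A `|` B &
        forall x y, set_val (i x) = set_val (j y) <->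
          exists z : sphere R k,
            set_val x = set_val z /\ set_val y = set_val (h z)].

(* bP^(n+1) as a subset of Gamma_n: the dimension n + 1 is that of K * K *)
Definition bP (k : nat) : set (Gamma R k) :=
  [set x | exists h : Diffp R k, isotopy_class h = x /\
    exists (N : nat) (W : set 'rV[R]_N),
      [/\ compact W, manifold (cd_dim k.+1) W,
          parallelizable (cd_dim k.+1) W &
          twisted_double h (manifold_boundary (cd_dim k.+1) W)]].

End Bounding.

Arguments bP R k : clear implicits.

Definition generated_by {G : groupType} (g : G) : set G :=
  [set x | exists n : nat, x = (g ^+ n)%g \/ x = (g ^- n)%g].

(* Main.v *)
From HB Require Import structures.
Require Import Defs.
From mathcomp Require Import all_boot all_order all_algebra.
From mathcomp Require Import all_classical all_reals all_analysis.
From mathcomp Require Import ring.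
Import Order.TTheory GRing.Theory Num.Theory.
Import numFieldNormedType.Exports.
Local Open Scope classical_set_scope.
Local Open Scope ring_scope.

(* By Artin's theorem [p] and [w] generate an associative subalgebra [S].
   Write [b = b(p,w)] and [C z = b z b^-1], an automorphism of [S] that commutes
   with conjugation and preserves the norm.  Then [sigma (p, w) = (C p, C w)] and
   [b (- C p, - C w) = C (b (- p, w)) = C b^-1 = b^-1], so that applying [sigma]
   to [- sigma (p, w)] undoes [C].  The antipodal action is by automorphisms of
   Gamma, and it inverts the generator. *)

Section CayleyDicksonAlgebra.
Context {R : realType}.

Local Notation "x ** y" := (cd_mul x y) (at level 40, left associativity).
Local Notation "1k" := (cd_of_real 1).

(** * Pairs, conjugation and bilinearity of the Cayley-Dickson product *)

Lemma cdfst_pair k (a b : cd R k) : cdfst (cdpair a b) = a.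
Proof. exact: row_mxKl. Qed.

Lemma cdsnd_pair k (a b : cd R k) : cdsnd (cdpair a b) = b.
Proof. exact: row_mxKr. Qed.

Lemma cdpair_eta k (x : cd R k.+1) : cdpair (cdfst x) (cdsnd x) = x.
Proof. exact: hsubmxK. Qed.

Lemma cdpair_ind k (P : cd R k.+1 -> Prop) :
  (forall a b, P (cdpair a b)) -> forall x, P x.
Proof. by move=> Pab x; rewrite -(cdpair_eta _ x). Qed.

Lemma cdpairD k (a b c d : cd R k) :
  cdpair a b + cdpair c d = cdpair (a + c) (b + d).
Proof. exact: add_row_mx. Qed.

Lemma cdpairZ k r (a b : cd R k) : r *: cdpair a b = cdpair (r *: a) (r *: b).
Proof. exact: scale_row_mx. Qed.

Lemma cdpairN k (a b : cd R k) : - cdpair a b = cdpair (- a) (- b).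
Proof. exact: opp_row_mx. Qed.

Lemma cd_mul_pair k (a b c d : cd R k) :
  cdpair a b ** cdpair c d =
  cdpair (a ** c - cd_conj d ** b) (d ** a + b ** cd_conj c).
Proof. by rewrite /= !cdfst_pair !cdsnd_pair. Qed.

Lemma cd_conj_pair k (a b : cd R k) :
  cd_conj (cdpair a b) = cdpair (cd_conj a) (- b).
Proof. by rewrite /= cdfst_pair cdsnd_pair. Qed.

Lemma cd_conj_linear k : linear (@cd_conj R k).
Proof.
elim: k => [//|k IH] r; elim/cdpair_ind => a b; elim/cdpair_ind => c d.
rewrite cdpairZ cdpairD !cd_conj_pair IH cdpairZ cdpairD; congr cdpair.
by rewrite opprD scalerN.
Qed.

HB.instance Definition _ k :=
  GRing.isLinear.Build R (cd R k) (cd R k) _ (@cd_conj R k) (cd_conj_linear k).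

Lemma cd_conjN k (x : cd R k) : cd_conj (- x) = - cd_conj x.
Proof. exact: linearN. Qed.

Lemma cd_conjD k (x y : cd R k) : cd_conj (x + y) = cd_conj x + cd_conj y.
Proof. exact: linearD. Qed.

Lemma cd_conjB k (x y : cd R k) : cd_conj (x - y) = cd_conj x - cd_conj y.
Proof. exact: linearB. Qed.

Lemma cd_conjZ k r (x : cd R k) : cd_conj (r *: x) = r *: cd_conj x.
Proof. exact: linearZ. Qed.

(** Both sides are proved in one induction: each component of a product of pairs contains the
    entries of either factor once on the left and once on the right. *)
Lemma cd_mul_bilinear k :
  (forall x, linear (@cd_mul R k x)) /\ (forall y, linear (@cd_mul R k ^~ y)).
Proof.
elim: k => [|k [IHr IHl]].
  by split=> x r y z; apply/rowP => i; rewrite !mxE; ring.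
pose ml y : {linear cd R k -> cd R k} := HB.pack (@cd_mul R k ^~ y)
  (GRing.isLinear.Build _ _ _ _ _ (IHl y)).
pose mr x : {linear cd R k -> cd R k} := HB.pack (@cd_mul R k x)
  (GRing.isLinear.Build _ _ _ _ _ (IHr x)).
have mlE r x y z : (r *: x + y) ** z = r *: (x ** z) + y ** z := linearP (ml z) r x y.
have mrE r x y z : z ** (r *: x + y) = r *: (z ** x) + z ** y := linearP (mr z) r x y.
split; elim/cdpair_ind => a b r; elim/cdpair_ind => c d;
  elim/cdpair_ind => e f; rewrite cdpairZ cdpairD !cd_mul_pair ?cd_conj_linear ?mlE ?mrE;
  rewrite cdpairZ cdpairD; congr cdpair; rewrite ?mlE ?mrE;
  by rewrite ?scalerBr ?scalerDr ?opprD addrACA.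
Qed.

HB.instance Definition _ k (x : cd R k) :=
  GRing.isLinear.Build R (cd R k) (cd R k) _ (cd_mul x) ((cd_mul_bilinear k).1 x).

Lemma cd_mulDr k (x y z : cd R k) : x ** (y + z) = x ** y + x ** z.
Proof. exact: linearD. Qed.

Lemma cd_mulNr k (x y : cd R k) : x ** (- y) = - (x ** y).
Proof. exact: linearN. Qed.

Lemma cd_mulZr k r (x y : cd R k) : x ** (r *: y) = r *: (x ** y).
Proof. exact: linearZ. Qed.

Lemma cd_mulBr k (x y z : cd R k) : x ** (y - z) = x ** y - x ** z.
Proof. exact: linearB. Qed.

Lemma cd_mulPl k r (x y z : cd R k) : (r *: x + y) ** z = r *: (x ** z) + y ** z.
Proof. exact: (cd_mul_bilinear k).2. Qed.

Lemma cd_mulDl k (x y z : cd R k) : (x + y) ** z = x ** z + y ** z.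
Proof. by have := cd_mulPl k 1 x y z; rewrite !scale1r. Qed.

Lemma cd_mul0l k (z : cd R k) : 0 ** z = 0.
Proof. by apply: (addIr (0 ** z)); rewrite -cd_mulDl !add0r. Qed.

Lemma cd_mulZl k r (x z : cd R k) : (r *: x) ** z = r *: (x ** z).
Proof. by have := cd_mulPl k r x 0 z; rewrite cd_mul0l !addr0. Qed.

Lemma cd_mulNl k (x z : cd R k) : (- x) ** z = - (x ** z).
Proof. by rewrite -scaleN1r cd_mulZl scaleN1r. Qed.

Lemma cd_mulBl k (x y z : cd R k) : (x - y) ** z = x ** z - y ** z.
Proof. by rewrite cd_mulDl cd_mulNl. Qed.

(** * Unit, real part, norm and the quadratic relation *)

Lemma cd_of_realE k r : cd_of_real r = r *: 1k :> cd R k.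
Proof.
elim: k => [|k IH]; first by apply/rowP => i; rewrite !mxE mulr1.
by rewrite /= cdpairZ -IH scaler0.
Qed.

Lemma cd_conj1 k : cd_conj 1k = 1k :> cd R k.
Proof. by elim: k => [//|k IH]; rewrite /= cdfst_pair cdsnd_pair IH oppr0. Qed.

Lemma cd_one_re k : cd_re (1k : cd R k) = 1.
Proof. by elim: k => [|k IH]; rewrite /= ?mxE // cdfst_pair IH. Qed.

Lemma cd_one_neq0 k : 1k != 0 :> cd R k.
Proof.
apply/eqP => /(congr1 cd_re); rewrite cd_one_re => H.
suff : cd_re (0 : cd R k) = 0 by move/eqP; rewrite -H oner_eq0.
(* The real part is odd, so its value at 0 is its own opposite. *)
by have /eqP := @cd_reN R k 0; rewrite oppr0 -addr_eq0 -mulr2n mulrn_eq0 => /eqP.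
Qed.

Lemma cd_mul1 k : (forall x : cd R k, 1k ** x = x) /\ (forall x : cd R k, x ** 1k = x).
Proof.
elim: k => [|k [IHl IHr]].
  by split=> x; apply/rowP => i; rewrite !mxE ?mul1r ?mulr1 ord1.
split; elim/cdpair_ind => a b; rewrite cd_mul_pair ?cd_conj1 ?IHl ?IHr ?linear0 ?cd_mul0l;
  by rewrite ?linear0 ?cd_mul0l ?subr0 ?addr0 ?add0r.
Qed.

Lemma cd_mul1l k (x : cd R k) : 1k ** x = x. Proof. exact: (cd_mul1 k).1. Qed.
Lemma cd_mul1r k (x : cd R k) : x ** 1k = x. Proof. exact: (cd_mul1 k).2. Qed.

Lemma cd_conjK k : involutive (@cd_conj R k).
Proof.
elim: k => [//|k IH]; elim/cdpair_ind => a b.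
by rewrite !cd_conj_pair IH opprK.
Qed.

Lemma cd_conjM k (x y : cd R k) : cd_conj (x ** y) = cd_conj y ** cd_conj x.
Proof.
elim: k x y => [|k IH]; first by move=> x y; apply/rowP => i; rewrite !mxE mulrC.
elim/cdpair_ind => a b; elim/cdpair_ind => c d.
rewrite !(cd_mul_pair, cd_conj_pair) cd_conjB !IH !cd_conjK.
rewrite cd_conjN !cd_mulNl !cd_mulNr opprK.
by congr cdpair; rewrite opprD addrC.
Qed.

(** The trace identity: it makes the conjugate a real combination of [1k] and [x], so every subspace
    containing [1k] is closed under conjugation. *)
Lemma cd_addC_conj k (x : cd R k) : x + cd_conj x = (2 * cd_re x) *: 1k.
Proof.
elim: k x => [|k IH]; first by move=> x; apply/rowP => i; rewrite !mxE !ord1 /=; ring.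
elim/cdpair_ind => a b.
by rewrite cd_conj_pair cdpairD IH subrr /= cdfst_pair cdpairZ scaler0.
Qed.

Lemma cd_conjE k (x : cd R k) : cd_conj x = (2 * cd_re x) *: 1k - x.
Proof. by rewrite -cd_addC_conj addrC addKr. Qed.

Lemma cd_abs_sqr k (x : cd R k) : cd_abs x ^+ 2 = \sum_i x 0 i ^+ 2.
Proof. by rewrite sqr_sqrtr //; apply: sumr_ge0 => i _; exact: sqr_ge0. Qed.

Lemma cd_abs_pair k (a b : cd R k) :
  cd_abs (cdpair a b) ^+ 2 = cd_abs a ^+ 2 + cd_abs b ^+ 2.
Proof.
rewrite !cd_abs_sqr [LHS]big_split_ord /=; congr (_ + _); apply: eq_bigr => i _.
- by rewrite [cdpair a b _ _]row_mxEl.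
- by rewrite [cdpair a b _ _]row_mxEr.
Qed.

Lemma cd_abs_conj k (x : cd R k) : cd_abs (cd_conj x) ^+ 2 = cd_abs x ^+ 2.
Proof.
elim: k x => [//|k IH]; elim/cdpair_ind => a b.
by rewrite cd_conj_pair !cd_abs_pair IH cd_absN.
Qed.

Lemma cd_mul_conjr k (x : cd R k) : x ** cd_conj x = cd_abs x ^+ 2 *: 1k.
Proof.
elim: k x => [|k IH].
  by move=> x; apply/rowP => i; rewrite cd_abs_sqr big_ord1 !mxE mulr1.
elim/cdpair_ind => a b; rewrite cd_conj_pair cd_mul_pair cd_conjK cd_conjN cd_mulNl opprK.
(* The product of [cd_conj b] and [b] has the shape of the induction hypothesis once [b] is read as
   the conjugate of [cd_conj b]. *)
rewrite -{2}[b](cd_conjK k) !IH cd_mulNl addNr cd_abs_pair cd_abs_conj -scalerDl.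
by rewrite -[in LHS](scaler0 _ (cd_abs a ^+ 2 + cd_abs b ^+ 2)) -cdpairZ.
Qed.

Lemma cd_mul_conjl k (x : cd R k) : cd_conj x ** x = cd_abs x ^+ 2 *: 1k.
Proof. by rewrite -{2}[x]cd_conjK cd_mul_conjr cd_abs_conj. Qed.

(** Substituting the trace identity into [cd_mul_conjr] shows that every element is quadratic over
    the reals. This relation later replaces squares by linear terms. *)
Lemma cd_sqr k (x : cd R k) :
  x ** x = (2 * cd_re x) *: x - cd_abs x ^+ 2 *: 1k.
Proof.
by rewrite -cd_mul_conjr cd_conjE cd_mulBr cd_mulZr cd_mul1r opprB addrC subrK.
Qed.

Lemma cd_abs_eq0 k (x : cd R k) : (cd_abs x == 0) = (x == 0).
Proof.
rewrite -sqrf_eq0 cd_abs_sqr psumr_eq0; last by move=> i _; exact: sqr_ge0.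
apply/allP/eqP => [x0|-> i _]; last by rewrite /= mxE expr0n eqxx.
by apply/rowP => i; have := x0 i (mem_index_enum i); rewrite mxE sqrf_eq0 => /eqP.
Qed.

Lemma cd_abs_ge0 k (x : cd R k) : 0 <= cd_abs x.
Proof. exact: sqrtr_ge0. Qed.

(** Since [1k] is nonzero and norms are nonnegative, the product with the conjugate determines the
    norm; this is how [twist] is seen to preserve norms. *)
Lemma cd_abs_mul_conj k (x y : cd R k) :
  x ** cd_conj x = y ** cd_conj y -> cd_abs x = cd_abs y.
Proof.
rewrite !cd_mul_conjr => /eqP; rewrite -subr_eq0 -scalerBl scaler_eq0.
rewrite (negPf (cd_one_neq0 k)) orbF subr_eq0 => /eqP H.
by apply/eqP; rewrite -(eqrXn2 (n := 2)) ?cd_abs_ge0 ?H.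
Qed.

(** * Associators, and alternativity of the quaternions and the Cayley numbers *)

Definition associator {k} (x y z : cd R k) := x ** y ** z - x ** (y ** z).

Definition cd_associative k := forall x y z : cd R k, associator x y z = 0.
Definition cd_commutative k := forall x y : cd R k, x ** y = y ** x.

Definition cd_alternative k := forall x y : cd R k,
  associator x x y = 0 /\ associator y x x = 0.

Lemma cd_associativeP k : cd_associative k ->
  forall x y z : cd R k, x ** (y ** z) = x ** y ** z.
Proof. by move=> A x y z; apply/esym/eqP; rewrite -subr_eq0; exact/eqP/A. Qed.

Lemma cd_commutative0 : cd_commutative 0.
Proof. by move=> x y; apply/rowP => i; rewrite !mxE mulrC. Qed.

Lemma cd_commutative1 : cd_commutative 1.
Proof.
elim/cdpair_ind => a b; elim/cdpair_ind => c d; rewrite !cd_mul_pair.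
rewrite [a ** c]cd_commutative0 [cd_conj d ** b]cd_commutative0 /= addrC.
by rewrite [_ + cd_mul d a]addrC.
Qed.

Lemma cd_associative0 : cd_associative 0.
Proof. by move=> x y z; apply/rowP => i; rewrite !mxE; ring. Qed.

(** Commutativity and associativity of the components allow the factors of every triple product to
    be brought into a common order, after which both sides have the same terms. *)
Lemma cd_associativeS k :
  cd_commutative k -> cd_associative k -> cd_associative k.+1.
Proof.
move=> C /cd_associativeP A; elim/cdpair_ind => a b; elim/cdpair_ind => c d.
elim/cdpair_ind => e f.
have CA (x y z : cd R k) : x ** y ** z = x ** z ** y by rewrite -!A [y ** z]C.
apply/eqP; rewrite subr_eq0; apply/eqP.
rewrite !cd_mul_pair; congr cdpair.
- rewrite !cd_conjD !cd_conjM cd_conjK !cd_mulBl !cd_mulBr !cd_mulDl !cd_mulDr !A.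
rewrite [e ** _]C [a ** cd_conj f]C [cd_conj c ** _]C.
  rewrite [_ ** e ** b]CA [_ ** a ** d]CA [_ ** cd_conj c ** b]CA.
  by apply/rowP => i; rewrite !mxE; ring.
- rewrite !cd_conjB !cd_conjM cd_conjK ?cd_mulBl !cd_mulBr !cd_mulDl !A.
  rewrite [_ ** c ** a]CA [_ ** cd_conj e ** a]CA [_ ** cd_conj e ** cd_conj c]CA.
  rewrite [b ** cd_conj d]C [_ ** b ** f]CA [_ ** f]C.
  by apply/rowP => i; rewrite !mxE; ring.
Qed.

(** The law [conj_mulK] becomes the left alternative law when the conjugate is expressed by the
    trace identity and compared with [cd_sqr]. *)
Lemma cd_conj_associative_alternative k : cd_associative k -> cd_alternative k.+1.
Proof.
move=> /cd_associativeP A.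
(* Associativity of the components brings each entry of [x] next to its conjugate, where the product
   is a real scalar; the mixed terms cancel. *)
have conj_mulK (x y : cd R k.+1) : cd_conj x ** (x ** y) = cd_abs x ^+ 2 *: y.
  move: x y; elim/cdpair_ind => a b; elim/cdpair_ind => c d.
  rewrite cd_conj_pair !cd_mul_pair !cd_conjB !cd_conjD !cd_conjM !cd_conjK.
  rewrite cd_abs_pair cdpairZ; congr cdpair.
  - rewrite cd_mulBr cd_mulNr cd_mulDl opprK !A cd_mul_conjl.
    rewrite -[c ** cd_conj b ** b]A !cd_mul_conjl cd_mulZl cd_mul1l cd_mulZr cd_mul1r.
    by apply/rowP => i; rewrite !mxE; ring.
  - rewrite cd_mulDl cd_mulBr !cd_mulNl !A.
    rewrite -[d ** a ** _]A !cd_mul_conjr cd_mulZl cd_mul1l cd_mulZr cd_mul1r.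
    by apply/rowP => i; rewrite !mxE; ring.
have left_alt (x y : cd R k.+1) : associator x x y = 0.
  have := conj_mulK x y; rewrite /associator cd_sqr cd_conjE !cd_mulBl !cd_mulZl !cd_mul1l.
  by move=> <-; apply/rowP => i; rewrite !mxE; ring.
move=> x y; split=> //.
(* Conjugation reverses products, so it turns the left law for the conjugates into the right law for
   [x] and [y]. *)
have := left_alt (cd_conj x) (cd_conj y).
rewrite /associator -!cd_conjM -cd_conjB => /(congr1 cd_conj).
by rewrite cd_conjK linear0 => /eqP; rewrite subr_eq0 eq_sym -subr_eq0 => /eqP.
Qed.

Lemma cd_alternative2 : cd_alternative 2.
Proof.
by apply/cd_conj_associative_alternative/cd_associativeS;
  [exact: cd_commutative0|exact: cd_associative0].
Qed.

Lemma cd_alternative3 : cd_alternative 3.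
Proof.
apply/cd_conj_associative_alternative/cd_associativeS; first exact: cd_commutative1.
by apply: cd_associativeS; [exact: cd_commutative0|exact: cd_associative0].
Qed.

(** In an alternative algebra with the quadratic relation these four elements already span the
    unital subalgebra generated by [x] and [y]. *)
Definition pair_span {k} (x y : cd R k) : set (cd R k) :=
  [set z | exists a b c d : R, z = a *: 1k + b *: x + c *: y + d *: (x ** y)].

(** * Artin's theorem: the span is an associative subalgebra *)

Section Artin.
Context {k : nat} (alt : cd_alternative k) (x y : cd R k).
Local Notation S := (pair_span x y).

(** Linear induction: a property stable under linear combinations is tested on the four spanning
    elements. *)
Lemma pair_spanP (P : cd R k -> Prop) :
  (forall r u v, P u -> P v -> P (r *: u + v)) ->
  P 1k -> P x -> P y -> P (x ** y) -> forall z, S z -> P z.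
Proof.
move=> PL P1 Px Py Pxy _ [a [b [c [d ->]]]].
have P0 : P 0 by rewrite -(addNr 1k) -scaleN1r; exact: PL.
rewrite -[d *: _]addr0 -!addrA.
by do 4![apply: (PL _ _ _) => //].
Qed.

Lemma pair_span_lin r u v : S u -> S v -> S (r *: u + v).
Proof.
move=> [a [b [c [d ->]]]] [a' [b' [c' [d' ->]]]].
exists (r * a + a'), (r * b + b'), (r * c + c'), (r * d + d').
by apply/rowP => i; rewrite !mxE; ring.
Qed.

Lemma pair_span1 : S 1k.
Proof. by exists 1, 0, 0, 0; rewrite !scale0r !addr0 scale1r. Qed.

Lemma pair_span_l : S x.
Proof. by exists 0, 1, 0, 0; rewrite !scale0r !addr0 scale1r add0r. Qed.

Lemma pair_span_r : S y.
Proof. by exists 0, 0, 1, 0; rewrite !scale0r !addr0 scale1r !add0r. Qed.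

Lemma pair_span_mul_lr : S (x ** y).
Proof. by exists 0, 0, 0, 1; rewrite !scale0r scale1r !add0r. Qed.

Lemma pair_spanZ r u : S u -> S (r *: u).
Proof.
move=> Su; have -> : r *: u = (r - 1) *: u + u by rewrite scalerBl scale1r subrK.
exact: pair_span_lin.
Qed.

Lemma pair_spanD u v : S u -> S v -> S (u + v).
Proof. by move=> Su Sv; rewrite -[u]scale1r; exact: pair_span_lin. Qed.

Lemma pair_spanN u : S u -> S (- u).
Proof. by move=> Su; rewrite -scaleN1r; exact: pair_spanZ. Qed.

Lemma pair_spanB u v : S u -> S v -> S (u - v).
Proof. by move=> Su Sv; apply: pair_spanD => //; exact: pair_spanN. Qed.

Lemma pair_span_conj u : S u -> S (cd_conj u).
Proof.
by move=> Su; rewrite cd_conjE; apply: pair_spanB => //; exact/pair_spanZ/pair_span1.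
Qed.

Lemma pair_span_sqr u : S u -> S (u ** u).
Proof.
by move=> Su; rewrite cd_sqr; apply: pair_spanB; apply: pair_spanZ => //; exact: pair_span1.
Qed.

Lemma associatorDl (u u' v w : cd R k) :
  associator (u + u') v w = associator u v w + associator u' v w.
Proof. by rewrite /associator !cd_mulDl opprD addrACA. Qed.

Lemma associatorDm (u v v' w : cd R k) :
  associator u (v + v') w = associator u v w + associator u v' w.
Proof. by rewrite /associator !(cd_mulDl, cd_mulDr) opprD addrACA. Qed.

Lemma associatorDr (u v w w' : cd R k) :
  associator u v (w + w') = associator u v w + associator u v w'.
Proof. by rewrite /associator !cd_mulDr opprD addrACA. Qed.

Lemma associatorPl r (u u' v w : cd R k) :
  associator (r *: u + u') v w = r *: associator u v w + associator u' v w.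
Proof. by rewrite associatorDl /associator !cd_mulZl scalerBr. Qed.

Lemma associatorZm r (u v w : cd R k) :
  associator u (r *: v) w = r *: associator u v w.
Proof. by rewrite /associator cd_mulZr !cd_mulZl cd_mulZr scalerBr. Qed.

Lemma associatorPm r (u v v' w : cd R k) :
  associator u (r *: v + v') w = r *: associator u v w + associator u v' w.
Proof. by rewrite associatorDm associatorZm. Qed.

Lemma associatorPr r (u v w w' : cd R k) :
  associator u v (r *: w + w') = r *: associator u v w + associator u v w'.
Proof. by rewrite associatorDr /associator !cd_mulZr scalerBr. Qed.

(** Polarization: the left alternative law at [u + v] leaves only the two mixed associators, which
    therefore cancel. *)
Lemma associator_swapl (u v w : cd R k) : associator u v w = - associator v u w.
Proof.
have := (alt (u + v) w).1; rewrite associatorDl !associatorDm.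
by rewrite (alt u w).1 (alt v w).1 add0r addr0 => /eqP; rewrite addr_eq0 => /eqP.
Qed.

Lemma associator_swapr (u v w : cd R k) : associator u v w = - associator u w v.
Proof.
have := (alt (v + w) u).2; rewrite associatorDm !associatorDr.
by rewrite (alt v u).2 (alt w u).2 add0r addr0 => /eqP; rewrite addr_eq0 => /eqP.
Qed.

Lemma associator_rot (u v w : cd R k) : associator u v w = associator v w u.
Proof. by rewrite associator_swapl associator_swapr opprK. Qed.

Lemma cd_flexible (u v : cd R k) : u ** v ** u = u ** (v ** u).
Proof.
by apply/eqP; rewrite -subr_eq0 -/(associator u v u) associator_swapl (alt u v).2 oppr0.
Qed.

Lemma cd_left_alternative (u v : cd R k) : u ** (u ** v) = u ** u ** v.
Proof. by apply/eqP; rewrite eq_sym -subr_eq0 -/(associator u u v) (alt u v).1. Qed.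

Lemma cd_right_alternative (u v : cd R k) : v ** u ** u = v ** (u ** u).
Proof. by apply/eqP; rewrite -subr_eq0 -/(associator v u u) (alt u v).2. Qed.

Lemma pair_span_mulyx : S (y ** x).
Proof.
(* Polarizing the square of [x + y] expresses [y ** x] by squares, which lie in the span by the
   quadratic relation. *)
have -> : y ** x = (x + y) ** (x + y) - x ** x - y ** y - x ** y.
  by rewrite cd_mulDl !cd_mulDr; apply/rowP => i; rewrite !mxE; ring.
have Sxy : S (x + y) by apply: pair_spanD; [exact: pair_span_l|exact: pair_span_r].
by do 3?[apply: pair_spanB]; do ?apply: pair_span_sqr;
  rewrite //; [exact: pair_span_l|exact: pair_span_r|exact: pair_span_mul_lr].
Qed.

(** Bilinearity reduces the claim to products of spanning elements. The alternative laws turn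
    [(xy)y] and [x(xy)] into [x] times a square and a square times [y]; flexibility turns [y(xy)]
    into [(yx)y] and [(xy)x] into [x(yx)], which are products already treated. *)
Lemma pair_spanM u v : S u -> S v -> S (u ** v).
Proof.
have S1 := pair_span1; have Sx := pair_span_l; have Sy := pair_span_r.
have Sxy := pair_span_mul_lr; have Syx := pair_span_mulyx.
have lin (f : cd R k -> cd R k) : (forall r u v, f (r *: u + v) = r *: f u + f v) ->
    S (f 1k) -> S (f x) -> S (f y) -> S (f (x ** y)) -> forall z, S z -> S (f z).
  move=> fL; apply: (pair_spanP (fun z => S (f z))) => r u' v' Su Sv.
  by rewrite fL; exact: pair_span_lin.
have mulr w : S w -> S (x ** w) -> S (y ** w) -> S (x ** y ** w) ->
    forall z, S z -> S (z ** w).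
  move=> Sw; apply: (lin (fun z => z ** w)); last by rewrite cd_mul1l.
  by move=> r u' v'; rewrite cd_mulPl.
have mull w : S w -> S (w ** x) -> S (w ** y) -> S (w ** (x ** y)) ->
    forall z, S z -> S (w ** z).
  move=> Sw; apply: (lin (fun z => w ** z)); last by rewrite cd_mul1r.
  by move=> r u' v'; rewrite cd_mulDr cd_mulZr.
have mulry z : S z -> S (z ** y).
  apply: mulr => //; first exact: pair_span_sqr.
  rewrite cd_right_alternative cd_sqr cd_mulBr !cd_mulZr cd_mul1r.
  by apply: pair_spanB; exact: pair_spanZ.
have mullx z : S z -> S (x ** z).
  apply: mull => //; first exact: pair_span_sqr.
  rewrite cd_left_alternative cd_sqr cd_mulBl !cd_mulZl cd_mul1l.
  by apply: pair_spanB; exact: pair_spanZ.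
have mully z : S z -> S (y ** z).
  by apply: mull => //; [exact: pair_span_sqr|rewrite -cd_flexible; exact: mulry].
have mulxyx : S (x ** y ** x) by rewrite cd_flexible; exact: mullx.
have mullxy z : S z -> S (x ** y ** z).
  by apply: mull => //; [exact: mulry|exact: pair_span_sqr].
by move=> Su Sv; move: u Su; apply: mulr; auto.
Qed.

Lemma associator1 (u v : cd R k) :
  [/\ associator 1k u v = 0, associator u 1k v = 0 & associator u v 1k = 0].
Proof. by rewrite /associator !(cd_mul1l, cd_mul1r) !subrr. Qed.

(* With [a] this associator, [a = (x,y,xy)] and the rotation [a = (xy,x,y)] add up
   to [2a = ((xy)x)y - x(y(xy))], which by flexibility is [(x,yx,y) = - (x,xy,y) = a]. *)
Lemma associator_mul_self : associator x y (x ** y) = 0.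
Proof.
set a := associator x y (x ** y).
(* By the quadratic relation [c ** c] is a combination of [c] and [1k]. Taking [c] to be [x + y],
   [x] and [y] then yields [(x, xy + yx, y) = 0]. *)
have sqr0 c : associator x c y = 0 -> associator x (c ** c) y = 0.
  move=> c0; rewrite cd_sqr -scaleNr associatorDm !associatorZm c0.
  by have [_ -> _] := associator1 x y; rewrite !scaler0 addr0.
have xyx : associator x (y ** x) y = a.
  have := sqr0 (x + y); rewrite associatorDm (alt _ _).1 (alt _ _).2 addr0 => /(_ erefl).
  rewrite cd_mulDl !cd_mulDr !associatorDm (sqr0 x) ?(alt _ _).1 // (sqr0 y) ?(alt _ _).2 //.
  rewrite add0r addr0 associator_swapr -/a => /eqP.
  by rewrite addrC subr_eq0 => /eqP.
have e1 : a = (x ** y) ** (x ** y) - x ** (y ** (x ** y)) by [].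
have e2 : a = x ** y ** x ** y - (x ** y) ** (x ** y).
  by rewrite /a associator_rot associator_rot.
rewrite cd_flexible in e2; clearbody a.
rewrite /associator cd_flexible in xyx.
have : a + a = a by rewrite {1}e1 {1}e2 -xyx; apply/rowP => i; rewrite !mxE; ring.
by move=> /eqP; rewrite -subr_eq0 addrK => /eqP.
Qed.

(** The associator is trilinear and alternating and vanishes when an entry is [1k]. On spanning
    elements only the orderings of [x], [y], [x ** y] remain, and these reduce to
    [associator_mul_self]. *)
Lemma pair_span_associator u v w : S u -> S v -> S w -> associator u v w = 0.
Proof.
have a0 := associator_mul_self.
have PL (f : cd R k -> cd R k) :
    (forall r u v, f (r *: u + v) = r *: f u + f v) ->
    forall r u v, f u = 0 -> f v = 0 -> f (r *: u + v) = 0.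
  by move=> fL r u' v' fu fv; rewrite fL fu fv scaler0 addr0.
have flex (s t : cd R k) : associator s t s = 0 by rewrite associator_swapl (alt _ _).2 oppr0.
have a1 : associator y (x ** y) x = 0 by rewrite -associator_rot.
have a2 : associator (x ** y) x y = 0 by rewrite -associator_rot.
have b0 : associator y x (x ** y) = 0 by rewrite associator_swapl a0 oppr0.
have b1 : associator x (x ** y) y = 0 by rewrite -associator_rot.
have b2 : associator (x ** y) y x = 0 by rewrite -associator_rot.
(* The entries are freed from the spanning set one at a time: first the third, then the second,
   finally the first. *)
have gens s t : s \in [:: x; y; x ** y] -> t \in [:: x; y; x ** y] ->
    forall z, S z -> associator s t z = 0.
  rewrite !inE => s3 t3; apply: pair_spanP; first by apply: PL => r u' v'; exact: associatorPr.
    by have [] := associator1 s t.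
  1-3: by move/or3P: s3 => [] /eqP ->; move/or3P: t3 => [] /eqP ->;
    rewrite ?(alt _ _).1 ?(alt _ _).2 ?flex.
have genl s : s \in [:: x; y; x ** y] ->
    forall t z, S t -> S z -> associator s t z = 0.
  move=> s3 t z + Sz; move: t; apply: (pair_spanP (fun t => associator s t z = 0)).
  - by apply: PL => r u' v'; exact: associatorPm.
  - by have [] := associator1 s z.
  1-3: by apply: gens => //; rewrite !inE eqxx ?orbT.
move=> + Sv Sw; move: u; apply: (pair_spanP (fun u => associator u v w = 0)).
- by apply: PL => r u' v'; exact: associatorPl.
- by have [] := associator1 v w.
1-3: by apply: genl => //; rewrite !inE eqxx ?orbT.
Qed.

Lemma pair_spanA u v w : S u -> S v -> S w -> u ** (v ** w) = u ** v ** w.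
Proof.
by move=> Su Sv Sw; apply/esym/eqP; rewrite -subr_eq0; exact/eqP/pair_span_associator.
Qed.

End Artin.

(** * Conjugation by a unit element *)

Lemma cd_unit_conj k (b : cd R k) : b ** cd_conj b = 1k -> cd_conj b ** b = 1k.
Proof. by rewrite cd_mul_conjl -cd_mul_conjr. Qed.

(** The conjugate stands for the inverse of [b]: under [b ** cd_conj b = 1k] this is the inner
    automorphism by [b] on any span containing [b]. *)
Definition twist {k} (b z : cd R k) := b ** z ** cd_conj b.

Lemma twistD k (b z z' : cd R k) : twist b (z + z') = twist b z + twist b z'.
Proof. by rewrite /twist cd_mulDr cd_mulDl. Qed.

Lemma twistZ k r (b z : cd R k) : twist b (r *: z) = r *: twist b z.
Proof. by rewrite /twist cd_mulZr cd_mulZl. Qed.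

Lemma twistN k (b z : cd R k) : twist b (- z) = - twist b z.
Proof. by rewrite -scaleN1r twistZ scaleN1r. Qed.

Lemma twist1 k (b : cd R k) : b ** cd_conj b = 1k -> twist b 1k = 1k.
Proof. by rewrite /twist cd_mul1r. Qed.

Section Twist.
Context {k : nat} (alt : cd_alternative k) (x y : cd R k).
Local Notation S := (pair_span x y).
Local Notation A := (pair_spanA alt x y).
Local Notation M := (pair_spanM alt x y).
Local Notation J := (pair_span_conj x y).

Lemma pair_span_twist b z : S b -> S z -> S (twist b z).
Proof. by move=> Sb Sz; apply: M (J _ Sb); exact: M. Qed.

Lemma twist_conj b z : S b -> S z -> twist b (cd_conj z) = cd_conj (twist b z).
Proof. by move=> Sb Sz; rewrite /twist !cd_conjM cd_conjK A //; exact: J. Qed.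

Lemma twistK b z : b ** cd_conj b = 1k -> S b -> S z ->
  twist (cd_conj b) (twist b z) = z.
Proof.
move=> /cd_unit_conj bb Sb Sz; have Sb' := J _ Sb; have Sbz := M _ _ Sb Sz.
rewrite /twist cd_conjK -A //; last exact: M.
by rewrite -[_ ** cd_conj b ** b]A // bb cd_mul1r A // bb cd_mul1l.
Qed.

Lemma twistM b z z' : b ** cd_conj b = 1k -> S b -> S z -> S z' ->
  twist b z ** twist b z' = twist b (z ** z').
Proof.
move=> /cd_unit_conj bb Sb Sz Sz'; have Sb' := J _ Sb.
have Sbz := M _ _ Sb Sz; have Sbz' := M _ _ Sb Sz'.
rewrite /twist A //; last exact: M.
rewrite -[b ** z ** _ ** _]A // [cd_conj b ** _]A // bb cd_mul1l.
by rewrite -[b ** z ** z']A.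
Qed.

Lemma twist_unit b z : b ** cd_conj b = 1k -> z ** cd_conj z = 1k ->
  S b -> S z -> twist b z ** cd_conj (twist b z) = 1k.
Proof.
move=> bb zz Sb Sz; rewrite -twist_conj // twistM //; last exact: J.
by rewrite zz twist1.
Qed.

(** [twist b] respects products and conjugates and fixes real scalars, hence fixes [z ** cd_conj z],
    which determines the norm. *)
Lemma cd_abs_twist b z : b ** cd_conj b = 1k -> S b -> S z ->
  cd_abs (twist b z) = cd_abs z.
Proof.
move=> bb Sb Sz; apply: cd_abs_mul_conj; rewrite -twist_conj // twistM //; last exact: J.
by rewrite cd_mul_conjr twistZ twist1.
Qed.

Lemma pair_span_exp_pi z : S z -> S (cd_exp_pi z).
Proof.
move=> Sz; rewrite /cd_exp_pi cd_of_realE; apply: pair_span_lin; first exact: pair_span1.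
exact: pair_spanZ.
Qed.

(** The exponential is a real combination of [1k] and [z] whose coefficients depend only on the norm
    of [z]. *)
Lemma cd_exp_pi_twist b z : b ** cd_conj b = 1k -> S b -> S z ->
  cd_exp_pi (twist b z) = twist b (cd_exp_pi z).
Proof.
move=> bb Sb Sz; rewrite /cd_exp_pi cd_abs_twist // twistD twistZ.
by rewrite cd_of_realE twistZ twist1.
Qed.

End Twist.

(** * The exponential of imaginary elements, and the map b *)

Lemma cd_conj_imaginary k (p : cd R k) : cd_re p = 0 -> cd_conj p = - p.
Proof. by move=> p0; rewrite cd_conjE p0 mulr0 scale0r add0r. Qed.

Lemma cd_exp_piN k (p : cd R k) : cd_re p = 0 ->
  cd_exp_pi (- p) = cd_conj (cd_exp_pi p).
Proof.
move=> /cd_conj_imaginary pN; rewrite /cd_exp_pi cd_absN cd_conjD cd_of_realE.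
by rewrite !cd_conjZ cd_conj1 pN.
Qed.

Lemma cd_exp_pi_unit k (p : cd R k) : cd_re p = 0 ->
  cd_exp_pi p ** cd_conj (cd_exp_pi p) = 1k.
Proof.
move=> p0; rewrite -cd_exp_piN // /cd_exp_pi cd_absN scalerN cd_of_realE.
set c := cos _; set s := sin _ / _.
(* This is the identity for cosine and sine, with [s] the sine divided by the norm; if the norm is
   0, the second term vanishes and the cosine is 1. *)
have E : c ^+ 2 + s ^+ 2 * cd_abs p ^+ 2 = 1.
  rewrite /c /s; have [->|n0] := eqVneq (cd_abs p) 0.
    by rewrite mulr0 cos0 [0 ^+ 2]expr0n mulr0 addr0 expr1n.
  by rewrite expr_div_n divfK ?expf_neq0 // cos2Dsin2.
rewrite cd_mulDl !cd_mulBr !(cd_mulZl, cd_mulZr) !(cd_mul1l, cd_mul1r) cd_sqr p0.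
by rewrite -[RHS]scale1r -E; apply/rowP => i; rewrite !mxE; ring.
Qed.

Lemma bmap_twist k (p w : cd R k) : w != 0 ->
  bmap p w = twist ((cd_abs w)^-1 *: w) (cd_exp_pi p).
Proof. by move=> /negPf w0; rewrite /bmap w0 /twist cd_conjZ. Qed.

Lemma bmapNr k (p w : cd R k) : bmap p (- w) = bmap p w.
Proof.
rewrite /bmap oppr_eq0 cd_absN cd_conjN !scalerN.
by rewrite !cd_mulNl cd_mulNr opprK.
Qed.

(** * Equivariance of b, and sigma composed with the antipode *)

Section Sigma.
Context {k : nat} (alt : cd_alternative k) (p w : cd R k) (p0 : cd_re p = 0).
Local Notation S := (pair_span p w).
Local Notation Sp := (pair_span_l p w).
Local Notation Sw := (pair_span_r p w).

Lemma normalize_unit (v : cd R k) : v != 0 ->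
  ((cd_abs v)^-1 *: v) ** cd_conj ((cd_abs v)^-1 *: v) = 1k.
Proof.
rewrite -cd_abs_eq0 => v0; rewrite cd_conjZ cd_mulZl cd_mulZr cd_mul_conjr !scalerA.
by rewrite -[RHS]scale1r; congr (_ *: _); field.
Qed.

Lemma pair_span_bmap : S (bmap p w).
Proof.
have [w0|w0] := eqVneq w 0.
  by rewrite /bmap w0 eqxx; apply: pair_spanN; exact: pair_span1.
rewrite bmap_twist //; apply: pair_span_twist => //; first exact/pair_spanZ/Sw.
exact/pair_span_exp_pi/Sp.
Qed.

Lemma bmap_unit : bmap p w ** cd_conj (bmap p w) = 1k.
Proof.
have [w0|w0] := eqVneq w 0.
  by rewrite /bmap w0 eqxx cd_conjN cd_conj1 cd_mulNl cd_mulNr opprK cd_mul1l.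
rewrite bmap_twist //; apply: (twist_unit alt p w).
- exact: normalize_unit.
- exact: cd_exp_pi_unit.
- exact/pair_spanZ/Sw.
- exact/pair_span_exp_pi/Sp.
Qed.

(** For nonzero [w] the exponential of [- p] is the conjugate of that of [p], and [twist] commutes
    with conjugation; for [w = 0] the value -1 is its own conjugate. *)
Lemma bmapNl : bmap (- p) w = cd_conj (bmap p w).
Proof.
have [w0|w0] := eqVneq w 0; first by rewrite /bmap w0 eqxx cd_conjN cd_conj1.
rewrite !bmap_twist // -(twist_conj alt p w) ?cd_exp_piN //; first exact/pair_spanZ/Sw.
exact/pair_span_exp_pi/Sp.
Qed.

Lemma twist_eq0 b z : b ** cd_conj b = 1k -> S b -> S z ->
  (twist b z == 0) = (z == 0).
Proof.
by move=> bb Sb Sz; rewrite -!cd_abs_eq0 (cd_abs_twist alt p w).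
Qed.

(** The formula for [bmap] is built from norms, real scalars, products and conjugates, all respected
    by the automorphism [twist b] of the span. A general [q] is allowed so that [- p] can be
    inserted. *)
Lemma bmap_equivariant b q : b ** cd_conj b = 1k -> S b -> S q ->
  bmap (twist b q) (twist b w) = twist b (bmap q w).
Proof.
move=> bb Sb Sq; have [w0|w0] := eqVneq w 0.
  rewrite /bmap twist_eq0 //; last exact: Sw.
  by rewrite w0 eqxx twistN twist1.
rewrite !bmap_twist ?twist_eq0 //; last exact: Sw.
rewrite (cd_abs_twist alt p w) //; last exact: Sw.
rewrite (cd_exp_pi_twist alt p w) // -twistZ.
set u := _ *: w; have Su : S u by exact/pair_spanZ/Sw.
have Se := pair_span_exp_pi p w _ Sq.
(* Only the twists by [u] and by [twist b u] are unfolded; the twists by [b] stay folded and merge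
   by multiplicativity. *)
rewrite /(twist u) /(twist (twist b u)) -(twist_conj alt p w) //.
rewrite !(twistM alt p w) //; first exact: pair_spanM.
exact: pair_span_conj.
Qed.

Lemma sigma_pair (q v : cd R k) :
  sigma (cdpair q v) = cdpair (twist (bmap q v) q) (twist (bmap q v) v).
Proof. by rewrite /sigma cdfst_pair cdsnd_pair. Qed.

Lemma sigma_opp_sigma_pair : sigma (- sigma (cdpair p w)) = - cdpair p w.
Proof.
rewrite sigma_pair; set b := bmap p w.
have bb : b ** cd_conj b = 1k := bmap_unit.
have Sb : S b := pair_span_bmap; have Sb' := pair_span_conj p w _ Sb.
(* The sign of the second argument of [bmap] drops out, while that of the first is moved inside the
   twist so that equivariance applies with [q] equal to [- p]. *)
rewrite !cdpairN sigma_pair bmapNr -twistN bmap_equivariant //; last exact/pair_spanN/Sp.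
have -> : twist b (bmap (- p) w) = cd_conj b.
  by rewrite bmapNl -/b /twist bb cd_mul1l.
by rewrite twistN !twistN !(twistK alt p w) //; [exact: Sw|exact: Sp].
Qed.

End Sigma.

Lemma sigma_opp_sigma k (x : cd R k.+1) : cd_alternative k ->
  cd_re (cdfst x) = 0 -> sigma (- sigma x) = - x.
Proof.
move=> alt; rewrite -[in X in _ -> X](cdpair_eta k x); exact: sigma_opp_sigma_pair.
Qed.

End CayleyDicksonAlgebra.

(** * The relation between sigma and the antipode on the sphere *)

Lemma antipode_sigma (R : realType) k (s : Diffp R k) : cd_alternative (R := R) k ->
  (forall x, set_val (s x) = sigma (set_val x)) ->
  antipode \o s = (s^-1)%g \o antipode.
Proof.
move=> alt sE; apply/funext => x /=.
have sK : cancel s (s^-1)%g.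
  by move=> y; have /(congr1 (fun f : Diffp R k => f y)) := mulVg s.
(* Inserting the inverse of [s] after [s] on the left reduces the claim to an identity of points,
   [sigma (- sigma x) = - x]. *)
rewrite -[LHS]sK; congr ((s^-1)%g _); apply: val_inj.
rewrite [LHS]sE [X in sigma X](_ : _ = - sigma (set_val x)); last by rewrite -sE.
by apply: sigma_opp_sigma alt _; have [] := set_valP x.
Qed.

(** * The antipodal action on isotopy classes *)

Section Gamma.
Context {R : realType} {k : nat}.
Implicit Types (f g : Diffp R k) (x y : Gamma R k).

Lemma antipode_conjM f g : antipode_conj (f * g)%g = (antipode_conj f * antipode_conj g)%g.
Proof. by apply: diffp_inj => x /=; rewrite antipodeK. Qed.

Lemma gamma_antipodeM x y :
  gamma_antipode (x * y)%g = (gamma_antipode x * gamma_antipode y)%g.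
Proof.
elim/gamma_ind: x => f; elim/gamma_ind: y => g.
by rewrite [(_ * _)%g]gamma_mulE !gamma_antipodeE antipode_conjM [RHS]gamma_mulE.
Qed.

Lemma gamma_antipode1 : gamma_antipode 1%g = 1%g :> Gamma R k.
Proof. by apply: (mulgI (gamma_antipode 1%g)); rewrite -gamma_antipodeM !mulg1. Qed.

Lemma gamma_antipodeV x : gamma_antipode (x^-1)%g = ((gamma_antipode x)^-1)%g.
Proof.
by apply: (mulgI (gamma_antipode x)); rewrite -gamma_antipodeM !mulgV gamma_antipode1.
Qed.

Lemma gamma_antipodeX x n : gamma_antipode (x ^+ n)%g = (gamma_antipode x ^+ n)%g.
Proof.
elim: n => [|n IH]; first by rewrite !expg0 gamma_antipode1.
by rewrite !expgS gamma_antipodeM IH.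
Qed.

(** An endomorphism that inverts [x] sends each power of [x] to the same power of the inverse, which
    is the inverse of that power. *)
Lemma gamma_antipode_generated x : gamma_antipode x = (x^-1)%g ->
  forall y, generated_by x y -> gamma_antipode y = (y^-1)%g.
Proof.
move=> xV _ [n [->|->]]; rewrite ?gamma_antipodeV gamma_antipodeX xV;
  by rewrite ?expVgn ?invgK.
Qed.

Lemma generated_byV x y : generated_by x y -> generated_by x (y^-1)%g.
Proof. by move=> [n [->|->]]; exists n; [right|left; rewrite invgK]. Qed.

End Gamma.

Lemma antipode_conj_sigma (R : realType) k (s : Diffp R k) :
  cd_alternative (R := R) k -> (forall x, set_val (s x) = sigma (set_val x)) ->
  antipode_conj s = (s^-1)%g.
Proof.
move=> alt sE; apply: diffp_inj => x.
have /(congr1 (fun h => h (antipode x))) := antipode_sigma R k s alt sE.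
by rewrite /= antipodeK.
Qed.

(** The facts known from earlier work enter as hypotheses: [s] is an orientation-preserving
    diffeomorphism with the values of [sigma], and its class generates the group or [bP R 3]. *)
Theorem mainTheorem5 (R : realType) :
  [/\ forall (k : nat) (s : Diffp R k), k = 2%N \/ k = 3%N ->
        (forall x, set_val (s x) = sigma (set_val x)) ->
        antipode \o s = (s^-1)%g \o antipode /\
        antipode_conj s = (s^-1)%g,
      forall s : Diffp R 2,
        (forall x, set_val (s x) = sigma (set_val x)) ->
        generated_by (isotopy_class s) = setT ->
        forall x : Gamma R 2, gamma_antipode x = (x^-1)%g &
      forall s : Diffp R 3,
        (forall x, set_val (s x) = sigma (set_val x)) ->
        generated_by (isotopy_class s) = bP R 3 ->
        forall x : Gamma R 3, bP R 3 x ->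
          bP R 3 (gamma_antipode x) /\ gamma_antipode x = (x^-1)%g].
Proof.
have gen k (s : Diffp R k) : cd_alternative (R := R) k ->
    (forall x, set_val (s x) = sigma (set_val x)) ->
    forall x, generated_by (isotopy_class s) x -> gamma_antipode x = (x^-1)%g.
  move=> alt sE; apply: gamma_antipode_generated.
  by rewrite gamma_antipodeE antipode_conj_sigma // [RHS]gamma_invE.
split.
- move=> k s k23 sE; have alt : cd_alternative (R := R) k.
    by case: k23 => ->; [exact: cd_alternative2|exact: cd_alternative3].
  by split; [exact: antipode_sigma|exact: antipode_conj_sigma].
- by move=> s sE genT x; apply: (gen _ s cd_alternative2 sE); rewrite genT.
(* As [bP R 3] consists of the powers of the class of [s], it contains the inverse of each of its
   elements, so the action maps it to itself. *)
- move=> s sE genbP x; rewrite -genbP => sx.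
  rewrite (gen _ s cd_alternative3 sE) //; split => //; exact: generated_byV.
Qed.
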